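(* For any positive integers $n$, $m$, $c$ with $n\leq m$, the natural inclusion $\mathcal{VR}(\mathcal{F}_n^{[m]};2c)\hookrightarrow\mathcal{VR}(\mathcal{F}_n^{[m]};2(c+1))$ is homotopically trivial (null-homotopic).
   Context: $\mathcal{F}_n^{[m]}$ is the set of $n$-element subsets of $[m]=\{1,\dots,m\}$ with metric $d(A,B)=|A\triangle B|$. For a metric space $(X,d)$ and $r\ge 0$, $\mathcal{VR}(X;r)$ is the simplicial complex on $X$ whose simplices are the nonempty finite $\sigma\subseteq X$ with $d(x,y)\le r$ for all $x,y\in\sigma$. *)

(* Defs.v *)
From HB Require Import structures.
From mathcomp Require Import all_boot all_order all_algebra.
From mathcomp Require Import all_classical all_reals all_analysis.

Set Implicit Arguments.
Unset Strict Implicit.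
Unset Printing Implicit Defensive.

Import Order.TTheory GRing.Theory Num.Theory.
Import numFieldTopology.Exports.

Local Open Scope classical_set_scope.
Local Open Scope ring_scope.

Definition homotopic (R : realType) (X Y : topologicalType) (f g : X -> Y) :=
  exists H : R * X -> Y,
    [/\ {within `[0, 1] `*` [set: X], continuous H},
        forall x, H (0, x) = f x
      & forall x, H (1, x) = g x].

Definition null_homotopic (R : realType) (X Y : topologicalType) (f : X -> Y) :=
  exists y : Y, homotopic R f (cst y).

Record simplicial_complex (V : finType) := SimplicialComplex {
  simplices :> {set {set V}};
  simplex_neq0 : forall s : {set V}, s \in simplices -> s != finset.set0;
  simplex_face : forall s t : {set V}, s \in simplices ->
    t \subset s -> t != finset.set0 -> t \in simplices }.

Definition subcomplex (V : finType) (K L : simplicial_complex V) :=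
  (K : {set {set V}}) \subset (L : {set {set V}}).

Definition bary_coords (R : realType) (V : finType)
    (K : simplicial_complex V) : set {ptws V -> R} :=
  [set x | [/\ forall v, 0 <= x v, \sum_v x v = 1
             & [set v | x v != 0]%SET \in simplices K]].

(* The vertex set being finite, the coherent (weak) topology is the one induced
   by the product topology of V -> R, which is the library's topology on the
   subtype associated with bary_coords K. *)
Definition realization (R : realType) (V : finType)
    (K : simplicial_complex V) : topologicalType :=
  set_type (bary_coords (R := R) K).

Lemma bary_coords_subcomplex (R : realType) (V : finType)
    (K L : simplicial_complex V) :
  subcomplex K L -> bary_coords (R := R) K `<=` bary_coords L.
Proof. by move=> /fintype.subsetP KL x [x0 x1 /KL]. Qed.

Definition realization_incl (R : realType) (V : finType)
    (K L : simplicial_complex V) (KL : subcomplex K L)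
    (x : realization R K) : realization R L :=
  SigSub (mem_set (bary_coords_subcomplex KL (set_mem (valP x)))).

#[short(type="finMetricType")]
HB.structure Definition FinMetric (R : numDomainType) :=
  { X of Metric R X & Finite X }.

Section vietoris_rips.
Context (R : realType) (X : finMetricType R).

Definition vr_simplices (r : R) : {set {set X}} :=
  [set s : {set X} | (s != finset.set0) &&
     [forall x in s, forall y in s, mdist x y <= r]]%SET.

Lemma vr_simplex_neq0 (r : R) (s : {set X}) :
  s \in vr_simplices r -> s != finset.set0.
Proof. by rewrite finset.inE => /andP[]. Qed.

Lemma vr_simplex_face (r : R) (s t : {set X}) : s \in vr_simplices r ->
  t \subset s -> t != finset.set0 -> t \in vr_simplices r.
Proof.
rewrite !finset.inE => /andP[_ /forall_inP sr] /fintype.subsetP ts -> /=.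
apply/forall_inP => x /ts xs; apply/forall_inP => y /ts ys.
by have /forall_inP := sr x xs; exact.
Qed.

Definition VR (r : R) : simplicial_complex X :=
  SimplicialComplex (@vr_simplex_neq0 r) (@vr_simplex_face r).

Lemma VR_subcomplex (r r' : R) : r <= r' -> subcomplex (VR r) (VR r').
Proof.
move=> rr'; apply/fintype.subsetP => s; rewrite !finset.inE.
move=> /andP[-> /forall_inP sr] /=.
apply/forall_inP => x xs; apply/forall_inP => y ys.
by have /forall_inP/(_ y ys)/le_trans := sr x xs; exact.
Qed.

Definition VR_incl (r r' : R) (rr' : r <= r') :
    realization R (VR r) -> realization R (VR r') :=
  realization_incl (VR_subcomplex rr').

End vietoris_rips.

(* [m] = {1, .., m} is represented by 'I_m. The base field is a parameter of
   the type because the library's metric structure depends on it. *)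
Definition nsubsets (R : realType) (n m : nat) : Type :=
  {A : {set 'I_m} | #|A| == n}.

HB.instance Definition _ (R : realType) (n m : nat) :=
  Finite.copy (nsubsets R n m) {A : {set 'I_m} | #|A| == n}.

Section nsubsets_metric.
Context (R : realType) (n m : nat).
Implicit Types A B C : nsubsets R n m.

Definition symdiff (T : finType) (A B : {set T}) : {set T} :=
  ((A :\: B) :|: (B :\: A))%SET.

Definition nsubsets_dist A B : R := #|symdiff (val A) (val B)|%:R.

Lemma nsubsets_distxx A : nsubsets_dist A A = 0.
Proof. by rewrite /nsubsets_dist /symdiff finset.setDv finset.setU0 cards0. Qed.

Lemma nsubsets_dist_eq0 A B : nsubsets_dist A B = 0 -> A = B.
Proof.
move=> /eqP; rewrite pnatr_eq0 cards_eq0 finset.setU_eq0 !finset.setD_eq0.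
by rewrite -finset.eqEsubset => /eqP/val_inj.
Qed.

Lemma nsubsets_dist_sym A B : nsubsets_dist A B = nsubsets_dist B A.
Proof. by rewrite /nsubsets_dist /symdiff finset.setUC. Qed.

Lemma nsubsets_dist_triangle B A C :
  nsubsets_dist A C <= nsubsets_dist A B + nsubsets_dist B C.
Proof.
rewrite -natrD ler_nat (leq_trans _ (leq_card_setU _ _))//.
apply/subset_leq_card/fintype.subsetP => x; rewrite !finset.inE.
by case: (x \in val A); case: (x \in val B); case: (x \in val C).
Qed.

HB.instance Definition _ := isMetric.Build R (nsubsets R n m)
  nsubsets_distxx nsubsets_dist_eq0 nsubsets_dist_sym nsubsets_dist_triangle.

End nsubsets_metric.

Lemma ler_double_succ (R : realType) (c : nat) :
  (2 * c)%N%:R <= (2 * (c + 1))%N%:R :> R.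
Proof. by rewrite ler_nat leq_mul2l leq_addr. Qed.

(* Main.v *)
(** Let [T] be a fixed [n]-subset of [m]. The compression [S_ij], which replaces
    [j] by [i] in the sets containing [j] but not [i], does not increase distances
    and moves every set by at most 2. Hence for any finite sequence of compressions
    two consecutive partial composites are contiguous as maps from [VR(2c)] to
    [VR(2c + 2)]. The composite of all [S_ij] with [i] in [T] and [j] outside [T]
    is constant: it sends [A] to a set [B] such that, for all such [i] and [j],
    [i \in B] or [j \notin B]; so [T] and [B] are comparable, hence equal by
    cardinality. *)

Require Import Defs.
From mathcomp Require Import all_boot all_order all_algebra.
From mathcomp Require Import all_classical all_reals all_analysis.
From mathcomp Require Import ring.

Set Implicit Arguments.
Unset Strict Implicit.
Unset Printing Implicit Defensive.

Import Order.TTheory GRing.Theory Num.Theory.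
Import numFieldNormedType.Exports.

Local Open Scope classical_set_scope.
Local Open Scope ring_scope.

(** The pointwise topology is the supremum of the topologies induced by the evaluations, so
    convergence is tested one coordinate at a time; constant functions make each evaluation
    surjective, as [cvg_image] requires. *)
Lemma ptws_cvg (J I : Type) (T : topologicalType) (F : set_system J)
    (h : J -> I -> T) (f : I -> T) : Filter F ->
  (forall i, h j i @[j --> F] --> f i) -> {ptws, h @ F --> f}.
Proof.
move=> FF Ff; apply/cvg_sup => i.
apply/cvg_image; first by rewrite eqEsubset; split=> y // _; exists (cst y).
move=> A /Ff FA; exists ((fun g : I -> T => g i) @^-1` A) => //.
by rewrite eqEsubset; split=> [_ [g + <-]//|y Ay]; exists (cst y).
Qed.

(** * Homotopies between realizations from chains of contiguous maps *)

Section contiguous_maps.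
Context (R : realType) (V : finType).
Implicit Types (K L : simplicial_complex V) (f g : V -> V) (x : V -> R)
  (phi : nat -> V -> V) (s a : R).

Definition contiguous K L f g :=
  forall t, t \in simplices K -> (f @: t :|: g @: t)%SET \in simplices L.

(** The map induced by [f] on barycentric coordinates, that is, the affine extension of the vertex
    map. *)
Definition pushforward f x (w : V) : R := \sum_(v | f v == w) x v.

Lemma sum_pushforward f x : \sum_w pushforward f x w = \sum_v x v.
Proof. by rewrite [RHS](partition_big f predT). Qed.

Lemma pushforward_ge0 f x w : (forall v, 0 <= x v) -> 0 <= pushforward f x w.
Proof. by move=> x0; apply: sumr_ge0. Qed.

Lemma pushforward_neq0 f x w : pushforward f x w != 0 ->
  w \in (f @: [set v | x v != 0])%SET.
Proof.
move=> fx; suff [v /eqP <- xv] : exists2 v, f v == w & x v != 0.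
  by rewrite imset_f// finset.inE.
apply: contrapT => nex; move/eqP: fx; apply; apply: big1 => v fv.
by apply/eqP/negPn/negP => xv; apply: nex; exists v.
Qed.

Lemma pushforward_id x : pushforward id x = x.
Proof. by apply/funext => w; rewrite /pushforward big_pred1_eq. Qed.

Definition segment f g x a : V -> R :=
  fun w => (1 - a) * pushforward f x w + a * pushforward g x w.

(** The support of such a point lies in the union of the images of the support of [x] under [f] and
    [g], which contiguity makes a simplex of [L]. *)
Lemma segment_bary_coords K L f g x a : contiguous K L f g ->
  bary_coords K x -> 0 <= a <= 1 -> bary_coords L (segment f g x a).
Proof.
move=> fgKL [x0 x1 xK] /andP[a0 a1].
have sum1 : \sum_w segment f g x a w = 1.
  rewrite big_split/= -!mulr_sumr !sum_pushforward x1; ring.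
split=> //.
  by move=> w; rewrite addr_ge0// mulr_ge0 ?subr_ge0 ?pushforward_ge0.
apply: simplex_face (fgKL _ xK) _ _.
  apply/fintype.subsetP => w; rewrite !finset.inE => /eqP sw.
  apply/negPn/negP; rewrite negb_or => /andP[fw gw]; apply: sw; rewrite /segment.
  have /eqP -> : pushforward f x w == 0.
    by apply: contraNT fw => /pushforward_neq0.
  have /eqP -> : pushforward g x w == 0.
    by apply: contraNT gw => /pushforward_neq0.
  by rewrite !mulr0 addr0.
(* The support is nonempty, since coordinates that all vanish cannot sum to 1. *)
apply/eqP => /setP e; suff : \sum_w segment f g x a w = 0.
  by rewrite sum1 => /eqP; rewrite oner_eq0.
apply: big1 => w _; have := e w; rewrite !finset.inE.
by move=> /negbFE/eqP.
Qed.

(** Clamping to the unit interval keeps the polygon below inside the realization for every real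
    parameter, as a homotopy is typed on all of [R * X]. *)
Definition ramp s : R := Num.max 0 (Num.min s 1).

Lemma ramp_itv s : 0 <= ramp s <= 1.
Proof. by rewrite /ramp le_max lexx/= ge_max ler01 ge_min lexx orbT. Qed.

Lemma ramp_le0 s : s <= 0 -> ramp s = 0.
Proof. by move=> s0; rewrite /ramp max_l// ge_min s0. Qed.

Lemma ramp_ge1 s : 1 <= s -> ramp s = 1.
Proof. by move=> s1; rewrite /ramp min_r// max_r. Qed.

Lemma ramp_continuous : continuous ramp.
Proof.
move=> s; apply: (@continuous_max _ _ (cst 0) (fun s => Num.min s 1)).
  exact: cvg_cst.
by apply: (@continuous_min _ _ id (cst 1)); [exact: cvg_id|exact: cvg_cst].
Qed.

(* On [k, k + 1] all ramps but the k-th are constant, so the sum telescopes to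
   the segment from the push-forward by [phi k] to that by [phi k.+1]. *)
Definition polygon phi x (N : nat) s : V -> R :=
  fun w => pushforward (phi 0) x w +
    \sum_(k < N) ramp (s - k%:R) *
      (pushforward (phi k.+1) x w - pushforward (phi k) x w).

Lemma polygon_le0 phi x N s : s <= 0 ->
  polygon phi x N s = pushforward (phi 0) x.
Proof.
move=> s0; apply/funext => w; rewrite /polygon big1 ?addr0// => k _.
by rewrite ramp_le0 ?mul0r// subr_le0 (le_trans s0).
Qed.

Lemma polygon_ge phi x N s : N%:R <= s ->
  polygon phi x N s = pushforward (phi N) x.
Proof.
move=> Ns; apply/funext => w; rewrite /polygon.
under eq_bigr => k _.
  rewrite ramp_ge1 ?mul1r; last first.
    by rewrite lerBrDr (le_trans _ Ns)// nat1r ler_nat.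
  over.
rewrite -(big_mkord xpredT (fun k =>
  pushforward (phi k.+1) x w - pushforward (phi k) x w)).
by rewrite telescope_sumr// addrC subrK.
Qed.

(** Induction on [N]: for [s <= N] the new ramp vanishes and the old segment serves; beyond [N] the
    earlier ramps are all 1, so the new segment starts at the push-forward by [phi N]. *)
Lemma polygon_segment phi x N s :
  exists k a, 0 <= a <= 1 /\ polygon phi x N s = segment (phi k) (phi k.+1) x a.
Proof.
elim: N => [|N [k [a [a01 IH]]]].
  (* For [N = 0] the sum is empty, and the point is the initial end of the segment from [phi 0],
     whatever [phi 1] is. *)
  exists 0%N, 0; rewrite lexx ler01; split=> //; apply/funext => w.
  by rewrite /polygon /segment big_ord0 subr0 mul1r mul0r.
have polyS : polygon phi x N.+1 s = fun w => polygon phi x N s w +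
    ramp (s - N%:R) *
      (pushforward (phi N.+1) x w - pushforward (phi N) x w).
  by apply/funext => w; rewrite /polygon big_ord_recr/= addrA.
have [sN|Ns] := leP s N%:R.
  exists k, a; split=> //; rewrite polyS IH; apply/funext => w.
  by rewrite ramp_le0 ?subr_le0// mul0r addr0.
exists N, (ramp (s - N%:R)); split; first exact: ramp_itv.
rewrite polyS polygon_ge ?ltW//; apply/funext => w; rewrite /segment; ring.
Qed.

Lemma polygon_bary_coords K L phi x N s :
  (forall k, contiguous K L (phi k) (phi k.+1)) ->
  bary_coords K x -> bary_coords L (polygon phi x N s).
Proof.
move=> phiKL Kx; have [k [a [a01 ->]]] := polygon_segment phi x N s.
exact: segment_bary_coords (phiKL k) Kx a01.
Qed.

(** The factor [N%:R] rescales time so that the unit interval runs through all [N] segments. *)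
Lemma polygon_continuous K phi N :
  continuous (fun p : R * realization R K =>
    polygon phi (set_val p.2) N (N%:R * p.1) : {ptws V -> R}).
Proof.
move=> p; apply: ptws_cvg => w; rewrite /polygon.
have cval (v : V) : (set_val q.2 : V -> R) v @[q --> p] --> (set_val p.2 : V -> R) v.
  apply: (@cvg_comp _ _ _ (fun q : R * realization R K => set_val q.2)
    (@proj V (fun=> R) v) _ (nbhs (set_val p.2 : {ptws V -> R})));
    last exact: (@proj_continuous V (fun=> R) v).
  apply: (@cvg_comp _ _ _ snd (fun y : realization R K => set_val y)
    _ (nbhs p.2)); first exact: cvg_snd.
  exact: initial_continuous.
have cpush f : pushforward f (set_val q.2) w @[q --> p] -->
    pushforward f (set_val p.2) w.
  by apply: cvg_big => [|v _]; [exact: add_continuous|exact: cval].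
apply: cvgD; first exact: cpush.
apply: cvg_big => [|k _]; first exact: add_continuous.
apply: cvgM; last by apply: cvgB; exact: cpush.
apply: (@cvg_comp _ _ _ (fun q : R * realization R K => N%:R * q.1 - k%:R) ramp
  _ (nbhs (N%:R * p.1 - k%:R))); last exact: ramp_continuous.
apply: cvgB; last exact: cvg_cst.
by apply: cvgM; [exact: cvg_cst|exact: cvg_fst].
Qed.

Lemma contiguous_null_homotopic K L (KL : subcomplex K L) phi (N : nat) (v0 : V) :
  (forall k, contiguous K L (phi k) (phi k.+1)) ->
  phi 0%N = id -> phi N = cst v0 -> [set v0]%SET \in simplices L ->
  null_homotopic R (realization_incl (R := R) KL).
Proof.
move=> phiKL phi0 phiN v0L.
have Lv0 : bary_coords (R := R) L (fun w => (w == v0)%:R).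
  split=> [v||]; first exact: ler0n.
    by rewrite (bigD1 v0)//= eqxx big1 ?addr0// => v /negbTE ->.
  rewrite (_ : [set v | _]%SET = [set v0]%SET)//.
  by apply/setP => v; rewrite !finset.inE pnatr_eq0 eqb0 negbK.
pose H (p : R * realization R K) : realization R L :=
  SigSub (mem_set (polygon_bary_coords N (N%:R * p.1) phiKL (set_mem (valP p.2)))).
exists (SigSub (mem_set Lv0)), H; split.
- apply: continuous_subspaceT; apply: continuous_comp_initial.
  exact: (@polygon_continuous K phi N).
- move=> x; apply/val_inj => /=.
  by rewrite mulr0 polygon_le0// phi0 pushforward_id.
- move=> x; apply/val_inj => /=.
  have [_ x1 _] := set_mem (valP x).
  rewrite mulr1 polygon_ge// phiN; apply/funext => w.
  (* The push-forward by a constant map gathers the total mass 1 at [v0]; elsewhere the sum is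
     empty. *)
  rewrite /pushforward /cst eq_sym; case: eqP => _; last by rewrite big_pred0.
  by rewrite x1.
Qed.

End contiguous_maps.

(** A mixed distance from [f x] to [g y] is bounded through [f y]: at most [r] from [f x] to [f y],
    then at most [d]. *)
Lemma short_map_contiguous (R : realType) (X : finMetricType R) (r r' d : R)
    (f g : X -> X) :
  (forall x y, mdist (f x) (f y) <= mdist x y) ->
  (forall x y, mdist (g x) (g y) <= mdist x y) ->
  (forall x, mdist (f x) (g x) <= d) -> r + d <= r' ->
  contiguous (VR X r) (VR X r') f g.
Proof.
move=> f1 g1 fg rr' t.
rewrite !finset.inE => /andP[t0 /forall_inP tr].
have tr2 x y : x \in t -> y \in t -> mdist x y <= r.
  by move=> xt yt; have /forall_inP := tr x xt; exact.
(* [d] bounds a distance as soon as a vertex exists, so it is nonnegative and [r <= r']. *)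
have d0 x : x \in t -> 0 <= d by move=> xt; exact: le_trans (mdist_ge0 _ _) (fg x).
have fgr x y : x \in t -> y \in t -> mdist (f x) (g y) <= r'.
  move=> xt yt; apply: le_trans rr'.
  apply: le_trans (metric_triangle _ (f y) _) _.
  by apply: lerD => //; apply: le_trans (f1 _ _) (tr2 _ _ xt yt).
have le_r' x y : x \in t -> y \in t -> mdist x y <= r'.
  move=> xt yt; apply: le_trans rr'; apply: le_trans (tr2 _ _ xt yt) _.
  by rewrite lerDl (d0 x).
apply/andP; split.
  have [x xt] := set0Pn _ t0; apply/set0Pn; exists (f x).
  by rewrite finset.inE imset_f.
apply/forall_inP => _ /finset.setUP[]/imsetP[x xt ->];
  apply/forall_inP => _ /finset.setUP[]/imsetP[y yt ->].
- exact: le_trans (f1 _ _) (le_r' _ _ xt yt).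
- exact: fgr.
- by rewrite metric_sym fgr.
- exact: le_trans (g1 _ _) (le_r' _ _ xt yt).
Qed.

(** * Compressions of subsets of a finite type *)

Section compression.
Context (T : finType).
Implicit Types (i j x : T) (A B D : {set T}).

Definition compress i j A : {set T} :=
  if (j \in A) && (i \notin A) then (i |: A :\ j)%SET else A.

Lemma card_compress i j A : #|compress i j A| = #|A|.
Proof.
rewrite /compress; case: ifP => // /andP[jA iA].
by rewrite cardsU1 !finset.inE negb_and iA orbT (cardsD1 j A) jA.
Qed.

Lemma in_compress_l i j A : i \in A -> i \in compress i j A.
Proof. by move=> iA; rewrite /compress iA andbF. Qed.

Lemma notin_compress_r i j A : j \notin A -> j \notin compress i j A.
Proof. by move=> jA; rewrite /compress (negbTE jA). Qed.

Lemma in_compress_neq i j A x : x != i -> x != j ->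
  (x \in compress i j A) = (x \in A).
Proof.
move=> /negbTE xi /negbTE xj; rewrite /compress.
by case: ifP; rewrite ?finset.inE ?xi ?xj.
Qed.

Lemma compress_or i j A : (i \in compress i j A) || (j \notin compress i j A).
Proof.
rewrite /compress; case: ifP => [_|/negbT]; first by rewrite !finset.inE eqxx.
by rewrite negb_and negbK orbC.
Qed.

(** Isolates the two elements whose membership a compression can change. *)
Lemma card_split2 i j D : i != j ->
  #|D| = ((i \in D) + (j \in D) + #|D :\ i :\ j|)%N.
Proof.
move=> ij; rewrite (cardsD1 i D) (cardsD1 j (D :\ i)%SET) !finset.inE.
by rewrite eq_sym ij addnA.
Qed.

(** Away from [i] and [j] the symmetric difference is unchanged, so only the contributions of these
    two elements are compared, over the 16 membership patterns. *)
Lemma card_symdiff_compress i j A B :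
  (#|symdiff (compress i j A) (compress i j B)| <= #|symdiff A B|)%N.
Proof.
(* If [i = j], the condition for moving is contradictory and the compression is the identity. *)
have [<-|ij] := eqVneq i j.
  have cid C : compress i i C = C by rewrite /compress andbN.
  by rewrite !cid.
rewrite (card_split2 (symdiff (compress _ _ _) _) ij).
rewrite (card_split2 (symdiff A B) ij).
rewrite (_ : (symdiff (compress i j A) (compress i j B) :\ i :\ j)%SET =
             (symdiff A B :\ i :\ j)%SET); last first.
  apply/setP => x; rewrite !finset.inE.
  case: (eqVneq x j) => //= xj; case: (eqVneq x i) => //= xi.
  by rewrite !in_compress_neq.
rewrite leq_add2r /symdiff !finset.inE /compress.
have ji : (j == i) = false by rewrite eq_sym (negbTE ij).
case: (boolP (i \in A)) => iA; case: (boolP (j \in A)) => jA;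
  case: (boolP (i \in B)) => iB; case: (boolP (j \in B)) => jB;
  by rewrite /= ?finset.inE ?eqxx ?ji ?(negbTE ij) ?iA ?jA ?iB ?jB
    ?(negbTE iA) ?(negbTE jA) ?(negbTE iB) ?(negbTE jB).
Qed.

Lemma card_symdiff_compress_id i j A : (#|symdiff A (compress i j A)| <= 2)%N.
Proof.
apply: (@leq_trans #|[set i; j]%SET|); last by rewrite cards2; case: (i != j).
apply/subset_leq_card/fintype.subsetP => x; apply: contraLR.
rewrite !finset.inE negb_or => /andP[xi xj].
by rewrite in_compress_neq//; case: (x \in A).
Qed.

End compression.

(** * Sequences of compressions acting on the [n]-subsets *)

Section compress_nsubsets.
Context (R : realType) (n m : nat).
Implicit Types (A B : nsubsets R n m) (i j : 'I_m) (p : 'I_m * 'I_m)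
  (s : seq ('I_m * 'I_m)).

Lemma compress_subproof i j A : #|compress i j (val A)| == n.
Proof. by rewrite card_compress (valP A). Qed.

Definition compressn p A : nsubsets R n m :=
  exist _ (compress p.1 p.2 (val A)) (compress_subproof p.1 p.2 A).

(** With a left fold the head acts first, so lengthening a prefix of [s] by one pair composes with
    one more compression on the outside. *)
Definition compress_seq s A := foldl (fun B p => compressn p B) A s.

Lemma compress_seq_rcons s p A :
  compress_seq (rcons s p) A = compressn p (compress_seq s A).
Proof. by rewrite /compress_seq foldl_rcons. Qed.

Lemma mdist_compressn p A B : mdist (compressn p A) (compressn p B) <= mdist A B.
Proof. by rewrite ler_nat card_symdiff_compress. Qed.

Lemma mdist_compressn_id p A : mdist A (compressn p A) <= 2.
Proof. by rewrite ler_nat card_symdiff_compress_id. Qed.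

Lemma mdist_compress_seq s A B :
  mdist (compress_seq s A) (compress_seq s B) <= mdist A B.
Proof.
elim/last_ind: s => // s p IH; rewrite !compress_seq_rcons.
exact: le_trans (mdist_compressn _ _ _) IH.
Qed.

(* No compression of [s] undoes what an earlier one achieved, as it adds only
   elements of [T] and removes only elements outside [T]. *)
Lemma compress_seq_or (T : {set 'I_m}) s A p :
  {in s, forall q, q.1 \in T /\ q.2 \notin T} -> p \in s ->
  (p.1 \in val (compress_seq s A)) || (p.2 \notin val (compress_seq s A)).
Proof.
elim/last_ind: s => // s q IH sT; rewrite compress_seq_rcons mem_rcons in_cons.
have [-> _|pq /= ps] := eqVneq p q; first exact: compress_or.
have [p1 p2] : p.1 \in T /\ p.2 \notin T.
  by apply: sT; rewrite mem_rcons in_cons ps orbT.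
have [q1 q2] : q.1 \in T /\ q.2 \notin T.
  by apply: sT; rewrite mem_rcons in_cons eqxx.
have p1q2 : p.1 != q.2 by apply: contraNneq q2 => <-.
have p2q1 : p.2 != q.1 by apply: contraNneq p2 => ->.
have /orP[p1A|p2A] : (p.1 \in val (compress_seq s A)) ||
    (p.2 \notin val (compress_seq s A)).
  by apply: IH => // r rs; apply: sT; rewrite mem_rcons in_cons rs orbT.
- apply/orP; left => /=; have [e|p1q1] := eqVneq p.1 q.1.
    by rewrite e in_compress_l// -e.
  by rewrite in_compress_neq.
- apply/orP; right => /=; have [e|p2q2] := eqVneq p.2 q.2.
    by rewrite e notin_compress_r// -e.
  by rewrite in_compress_neq.
Qed.

Lemma compress_seq_cst (T : nsubsets R n m) s :
  (forall p, (p \in s) = (p.1 \in val T) && (p.2 \notin val T)) ->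
  compress_seq s = cst T.
Proof.
move=> sT; apply/funext => A; apply/val_inj => /=.
set B := val (compress_seq s A).
have cardn (C : nsubsets R n m) : #|val C| = n by case: C => ? ?; exact/eqP.
have cardB : #|B| = #|val T| by rewrite !cardn.
(* If some [i] of [T] is missing from [B], this single [i] forces every [j] of [B] into [T]; either
   inclusion is an equality by cardinality. *)
have [TB|/subsetPn[i iT iB]] := boolP (val T \subset B).
  by apply/esym/eqP; rewrite eqEcard TB cardB leqnn.
apply/eqP; rewrite eqEcard cardB leqnn andbT.
apply/fintype.subsetP => j jB; apply/negPn/negP => jT.
have : (i \in B) || (j \notin B); last by rewrite (negbTE iB) jB.
apply: (@compress_seq_or (val T) s A (i, j)); last by rewrite sT /= iT.
by move=> q; rewrite sT => /andP.
Qed.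

End compress_nsubsets.

Theorem theorem4p7 (R : realType) (n m c : nat) :
  (0 < n)%N -> (0 < m)%N -> (0 < c)%N -> (n <= m)%N ->
  null_homotopic R
    (VR_incl (X := nsubsets R n m) (ler_double_succ R c)).
Proof.
move=> _ m0 _ nm.
have cardT : #|[set i : 'I_m | (i < n)%N]%SET| == n.
  rewrite -sum1_card (eq_bigl (fun i : 'I_m => (i < n)%N)); last first.
    by move=> i; rewrite finset.inE.
  by rewrite (big_ord_narrow nm) sum1_card card_ord.
pose T : nsubsets R n m := exist _ [set i : 'I_m | (i < n)%N]%SET cardT.
pose s := enum [pred p : 'I_m * 'I_m | (p.1 \in val T) && (p.2 \notin val T)].
(* The chain is stationary from [size s] on, so consecutive maps are contiguous for every [k]. *)
pose phi k := @compress_seq R n m (take k s).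
apply: (@contiguous_null_homotopic _ _ _ _ _ phi (size s) T).
(* The constant 2 is the largest displacement under one compression, and
   [2 * c + 2 = 2 * (c + 1)]. *)
- move=> k; apply: (@short_map_contiguous _ _ _ _ 2) => [A B|A B|A|].
  + exact: mdist_compress_seq.
  + exact: mdist_compress_seq.
  + have [ks|sk] := ltnP k (size s); last first.
      by rewrite /phi !take_oversize ?(leqW sk)// mdistxx.
    (* A default pair for [nth], available because [0 < m]; it is never returned since
       [k < size s]. *)
    pose p0 : 'I_m * 'I_m := (Ordinal m0, Ordinal m0).
    by rewrite /phi (take_nth p0 ks) compress_seq_rcons mdist_compressn_id.
  + by rewrite -natrD ler_nat mulnDr.
- by rewrite /phi take0.
- rewrite /phi take_size; apply: compress_seq_cst => p.
  by rewrite mem_enum.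
- rewrite finset.inE; apply/andP; split.
    by apply/set0Pn; exists T; rewrite finset.inE.
  apply/forall_inP => x /finset.set1P ->; apply/forall_inP => y /finset.set1P ->.
  by rewrite mdistxx ler0n.
Qed.
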